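(* Let $s$ be a prime power. For integers $N\ge 2$, $m\ge 1$ put $$L(N,m)=\frac{m(s-1)(ms-m-N+1)}{2(N-1)} + \frac{(N-1)s^2\,\eta(1-\eta)}{2N},\qquad \eta=\frac{m(N-s)}{(N-1)s}-\left\lfloor\frac{m(N-s)}{(N-1)s}\right\rfloor .$$ (i) For any positive integers $n$ and $k$, there exists a GMA-optimal $SSD(s^n,s^m)$ with $A_2=L(s^n,m)$, for $m=k(s^n-1)/(s-1)$ and for $m=k(s^n-1)/(s-1)\pm 1$ (whenever $m\ge 1$). (ii) For any positive integers $n$ and $k<s$, there exists a GMA-optimal $SSD(ks^{n-1},s^m)$ with $A_2=L(ks^{n-1},m)$, where $m=(s^n-1)/(s-1)-1$ (whenever $m\ge 1$, i.e. $n\ge 2$). (iii) For any $m\ge 1$, there exists a GMA-optimal $SSD(s^2,s^m)$ with $A_2=L(s^2,m)$. (iv) For any $1\le m\le s$ and any $1\le k<s$, there exists a GMA-optimal $SSD(ks,s^m)$ with $A_2=L(ks,m)$.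
   Context: Designs: $SSD(N,s^m)$ denotes an $N\times m$ matrix $D=[x_{ik}]$ with entries in a set of $s$ symbols, which is balanced: in every column each of the $s$ symbols appears exactly $N/s$ times. (SSD abbreviates ''supersaturated design''; only balanced ones are considered. Columns are allowed to be repeated or fully aliased.) Generalized wordlength pattern: choose orthonormal contrasts on the symbol set, i.e. complex-valued functions $c_1,\dots,c_{s-1}$ on the symbols with $\sum_x c_a(x)=0$ and $\sum_x c_a(x)\overline{c_b(x)}=s$ if $a=b$ and $0$ otherwise. For $j=1,\dots,m$, $$A_j(D)=N^{-2}\sum_{K\subseteq\{1,\dots,m\},\,|K|=j}\ \sum_{(a_k)_{k\in K}\in\{1,\dots,s-1\}^K}\Big|\sum_{i=1}^N\prod_{k\in K}c_{a_k}(x_{ik})\Big|^2 ,$$ independently of the choice of contrasts. GMA (generalized minimum aberration): $D$ is GMA-optimal if it sequentially minimizes $A_1,A_2,A_3,\dots$ among all designs with the same parameters, i.e. there is no $SSD(N,s^m)$ $D'$ and index $r$ with $A_j(D')=A_j(D)$ for all $j<r$ and $A_r(D')<A_r(D)$. The quantity $L(N,m)$ is a lower bound for $A_2$ over all $SSD(N,s^m)$. *)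

(* Defs.v *)
From HB Require Import structures.
From mathcomp Require Import all_boot all_order all_algebra.
From mathcomp Require Import reals.
From mathcomp Require Import complex.
From mathcomp Require Import cyclic separable cyclotomic.

Set Implicit Arguments.
Unset Strict Implicit.
Unset Printing Implicit Defensive.

Import Order.TTheory GRing.Theory Num.Theory.

Local Open Scope ring_scope.

Definition prime_power (s : nat) : Prop :=
  exists p e : nat, [/\ prime p, (0 < e)%N & s = (p ^ e)%N].

Section Designs.
Variables (s N m : nat).

(* Each count equals N / s; the product form also forces s to divide N. *)
Definition is_ssd (D : 'M['I_s]_(N, m)) : Prop :=
  forall (k : 'I_m) (x : 'I_s), (#|[set i | D i k == x]| * s)%N = N.

End Designs.

Section GMA.
Variables (R : realType) (s : nat).

(* The s - 1 contrasts are indexed from 0, by 'I_s.-1. *)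
Definition orthonormal_contrasts (c : 'I_s.-1 -> 'I_s -> R[i]) : Prop :=
  (forall a, \sum_x c a x = 0) /\
  (forall a b, \sum_x c a x * (c b x)^* = if a == b then s%:R else 0).

Variable c : 'I_s.-1 -> 'I_s -> R[i].
Variables (N m : nat).

(* [A_j(D)]: the inner sum is over the families (a_k) indexed by k in K, and
   [normc] is the modulus R[i] -> R. *)
Definition gwp (D : 'M['I_s]_(N, m)) (j : nat) : R :=
  N%:R ^- 2 *
  \sum_(K : {set 'I_m} | #|K| == j)
    \sum_(a : {ffun {k : 'I_m | k \in K} -> 'I_s.-1})
      ComplexField.Normc.normc
        (\sum_(i < N) \prod_(k : {k : 'I_m | k \in K}) c (a k) (D i (val k)))
      ^+ 2.

Definition gma_optimal (D : 'M['I_s]_(N, m)) : Prop :=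
  ~ exists (D' : 'M['I_s]_(N, m)) (r : nat),
      [/\ is_ssd D', (1 <= r <= m)%N,
          forall j : nat, (1 <= j < r)%N -> gwp D' j = gwp D j
        & gwp D' r < gwp D r].

End GMA.

Section Bound.
Variables (R : realType) (s N m : nat).

Definition eta : R :=
  let t : R := m%:R * (N%:R - s%:R) / ((N%:R - 1) * s%:R) in
  t - (Num.floor t)%:~R.

Definition A2_bound : R :=
  m%:R * (s%:R - 1) * (m%:R * s%:R - m%:R - N%:R + 1) / (2 * (N%:R - 1))
  + (N%:R - 1) * s%:R ^+ 2 * eta * (1 - eta) / (2 * N%:R).

(* One design serves for every choice of contrasts, so that the independence
   of [gwp] from [c] need not be presupposed. *)
Definition has_gma_ssd_attaining_bound : Prop :=
  exists D : 'M['I_s]_(N, m),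
    is_ssd D /\
    forall c : 'I_s.-1 -> 'I_s -> R[i], orthonormal_contrasts c ->
      gma_optimal c D /\ gwp c D 2 = A2_bound.

End Bound.

(* The quantification over contrasts is never vacuous: powers of a primitive
   s-th root of unity provide some. *)
Lemma orthonormal_contrasts_exist (R : realType) (s : nat) :
  (0 < s)%N ->
  exists c : 'I_s.-1 -> 'I_s -> R[i], orthonormal_contrasts c.
Proof.
move=> s_gt0.
have [w pw] : exists w : R[i], s.-primitive_root w.
  have [r Dp] := closed_field_poly_normal ('X^s - 1 : {poly R[i]}).
  rewrite (monicP _) ?monicXnsubC // scale1r in Dp.
  have rn1 : all s.-unity_root r by apply/allP=> z; rewrite -root_prod_XsubC -Dp.
  have sz_r : (s < (size r).+1)%N.
    by rewrite -(size_prod_XsubC r id) -Dp size_XnsubC.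
  have [|z] := hasP (has_prim_root s_gt0 rn1 _ sz_r); last by exists z.
  by rewrite -separable_prod_XsubC -Dp separable_Xn_sub_1 // pnatr_eq0 -lt0n.
have w0 : w != 0.
  apply: contra_eq_neq (prim_expr_order pw) => ->.
  by rewrite expr0n gtn_eqF // eq_sym oner_neq0.
have geo (z : R[i]) : z ^+ s = 1 -> z != 1 -> \sum_(x < s) z ^+ x = 0.
  move=> zs z1; rewrite -subr_eq0 in z1.
  by apply: (mulfI z1); rewrite -subrX1 zs subrr mulr0.
have ltS (a : 'I_s.-1) : (a.+1 < s)%N by rewrite -ltn_predRL.
have nw : `|w| = 1.
  apply/eqP; rewrite -(@pexpr_eq1 _ _ s) //.
  by rewrite -normrX (prim_expr_order pw) normr1.
have cw : w^* = w^-1.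
  by apply: (mulfI w0); rewrite divff // -normCK nw expr1n.
exists (fun a x => w ^+ (a.+1 * x)); split=> [a|a b].
  under eq_bigr do rewrite exprM.
  apply: geo; first by rewrite -exprM mulnC exprM (prim_expr_order pw) expr1n.
  by rewrite -(prim_order_dvd pw) gtnNdvd.
have E (x : 'I_s) :
    w ^+ (a.+1 * x) * (w ^+ (b.+1 * x))^* = (w ^+ a.+1 / w ^+ b.+1) ^+ x.
  by rewrite rmorphXn /= cw exprMn !exprVn -!exprM.
under eq_bigr do rewrite E.
case: eqP => [->|/eqP ab].
  rewrite divff ?expf_neq0 //; under eq_bigr do rewrite expr1n.
  by rewrite sumr_const card_ord.
apply: geo.
  rewrite expr_div_n -!exprM !(mulnC _ s) !exprM (prim_expr_order pw).
  by rewrite !expr1n divr1.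
apply: contra ab => /eqP h; apply/eqP/val_inj/succn_inj.
have /eqP : w ^+ a.+1 = w ^+ b.+1.
  by rewrite -[RHS]mul1r -h divfK // expf_neq0.
by rewrite (eq_prim_root_expr pw) /eqn !modn_small // => /eqP.
Qed.

(* Main.v *)
Require Import Defs.
From mathcomp Require Import all_boot all_order all_algebra.
From mathcomp Require Import reals.
From mathcomp Require Import complex finfield ring zify.

Set Implicit Arguments.
Unset Strict Implicit.
Unset Printing Implicit Defensive.

Import Order.TTheory GRing.Theory Num.Theory.

Local Open Scope ring_scope.

(** For rows [i], [j] of a design let [coinc D i j] be the number of columns in
    which they agree.  Expanding the squared moduli in [A_j] and summing over
    the contrasts, for which [\sum_a c_a(x) c_a(y)^* = s [x = y] - 1], gives
    [A_j(D) = N^-2 \sum_(i, i') P_j(coinc D i i')], where [P_j(d)] is the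
    coefficient of [z^j] in [(1 + (s - 1) z)^d (1 - z)^(m - d)] ([gwpE]).

    In a balanced design the sum of the coincidence numbers over [i != i'] is
    determined by the parameters, and [P_1] is affine, so [A_1] is constant.
    As [P_2] is quadratic with leading coefficient [s^2 / 2], for each integer
    [t] the number [A_2(D)] equals a constant plus a positive multiple of the
    sum over [i != i'] of [(d - t)(d - t - 1)], [d = coinc D i i']
    ([gwp2_excess]).  These terms are nonnegative, and vanish exactly when all
    coincidence numbers off the diagonal are [t] or [t + 1].  If such a design
    exists it therefore minimizes [A_2], with minimum [L(N, m)]; and all designs
    attaining this minimum have the same number of pairs with coincidence number
    [t], hence the same wordlength pattern.  So a design whose coincidence
    numbers off the diagonal lie in [{t, t + 1}] is optimal
    ([near_constant_gma]).

    It remains to exhibit such designs.  Let [F] be the field with [s] elements.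
    The rows are vectors [x] of [F^n], the columns are functionals
    [x |-> x . p] with [p] in a list, and two rows agree in column [p] when
    their difference is orthogonal to [p].  If [p] runs over the points of the
    projective space, every nonzero vector is orthogonal to the same number of
    points ([count_points_dot]): this design has constant coincidence numbers,
    and so have its [k]-fold repetitions, to or from which one column may be
    added or removed.  For [n = 2] the constant is 1, and repetitions of all the
    columns may be followed by an arbitrary part of them.  Lastly, keeping the
    rows whose first coordinate is in a set of [k] elements and dropping the
    column of that coordinate leaves a balanced design in which the coincidence
    numbers drop by at most one; for [n = 2] they then lie in [{0, 1}], and
    still do so for any part of the columns. *)

(** * Wordlength patterns and coincidence numbers *)

(** The number of columns in which the rows [i] and [j] agree. *)
Definition coinc (s N m : nat) (D : 'M['I_s]_(N, m)) (i j : 'I_N) : nat :=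
  #|[set k | D i k == D j k]|.

(** The Krawtchouk polynomial of degree [j] for words of length [m] over [s]
    symbols, as a function of the number [d] of agreements; it is meant for
    [d <= m]. *)
Definition krawtchouk (R : nzRingType) (s m j d : nat) : R :=
  ((1 + (s%:R - 1) *: 'X) ^+ d * (1 - 'X) ^+ (m - d))`_j.

(** Orthogonality of the columns of the table of contrasts. *)
Lemma contrasts_dual (R : realType) (s : nat) (c : 'I_s.-1 -> 'I_s -> R[i]) :
  orthonormal_contrasts c ->
  forall x y, \sum_a c a x * (c a y)^* = s%:R * (x == y)%:R - 1.
Proof.
case: s c => [|s] c; first by move=> _ [].
rewrite [s.+1.-1]/= in c *.
move=> [c0 cc] x y.
have sn0 : (s.+1%:R : R[i]) != 0 by rewrite pnatr_eq0.
(* The constant function 1 completes the contrasts to a square matrix M with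
   M M^* = s I, hence also M^* M = s I. *)
pose M : 'M[R[i]]_(1 + s, s.+1) := col_mx (const_mx 1) (\matrix_(a, x) c a x).
have Mu a z : M (lshift s a) z = 1 by rewrite col_mxEu mxE.
have Md a z : M (rshift 1 a) z = c a z by rewrite col_mxEd mxE.
clearbody M.
pose M' : 'M[R[i]]_(s.+1, 1 + s) := s.+1%:R^-1 *: (map_mx Num.conj M)^T.
have MM' : M *m M' = 1%:M.
  rewrite -scalemxAr; apply: (canLR (scalerK sn0)).
  rewrite scalemx1; apply/matrixP => a b; rewrite !mxE.
  under eq_bigr => z _ do rewrite !mxE.
  case: (split_ordP a) => a' ->; case: (split_ordP b) => b' ->.
  - under eq_bigr => z _ do rewrite !Mu rmorph1 mulr1.
    by rewrite sumr_const card_ord !ord1 eqxx mulr1n.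
  - under eq_bigr => z _ do rewrite Mu Md mul1r.
    by rewrite -rmorph_sum /= c0 rmorph0 eq_lrshift.
  - under eq_bigr => z _ do rewrite Mu Md rmorph1 mulr1.
    by rewrite c0 eq_rlshift.
  - under eq_bigr => z _ do rewrite !Md.
    by rewrite cc eq_rshift; case: eqP.
have /matrixP/(_ y x) := mulmx1C MM'.
rewrite !mxE big_split_ord /= big_ord1 !mxE !Mu rmorph1 mulr1.
under eq_bigr => a _ do rewrite !mxE !Md -mulrA [_^* * _]mulrC.
rewrite -mulr_sumr -mulrDr eq_sym => E.
by rewrite -E mulVKf // addrAC subrr add0r.
Qed.

Lemma gwpE (R : realType) (s : nat) (c : 'I_s.-1 -> 'I_s -> R[i]) (N m j : nat)
    (D : 'M['I_s]_(N, m)) :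
  (forall x y, \sum_a c a x * (c a y)^* = s%:R * (x == y)%:R - 1) ->
  gwp c D j = N%:R ^- 2 * \sum_i \sum_i' krawtchouk R s m j (coinc D i i').
Proof.
move=> dual; congr (_ * _).
apply: (@complexI R).
(* [b i i' k] is the sum over the contrasts in column k; the elementary
   symmetric functions of these numbers are the coefficients of the product of
   the 1 + b X, in which equal factors are then collected. *)
pose b i i' k : R := s%:R * (D i k == D i' k)%:R - 1.
have krawE i i' :
    krawtchouk R s m j (coinc D i i') =
    \sum_(K : {set 'I_m} | #|K| == j) \prod_(k in K) b i i' k.
  have -> : krawtchouk R s m j (coinc D i i') =
      (\prod_k (b i i' k *: 'X + 1))`_j.
    rewrite /krawtchouk (bigID (fun k => D i k == D i' k)) /=.
    rewrite (eq_bigr (fun=> 1 + (s%:R - 1) *: 'X)); last first.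
      by move=> k e; rewrite /b e mulr1 addrC.
    rewrite prodr_const [in RHS](eq_bigr (fun=> 1 - 'X)); last first.
      by move=> k /negbTE e; rewrite /b e mulr0 sub0r scaleN1r addrC.
    rewrite prodr_const /coinc cardsE.
    have /(canRL (addKn _)) := cardC (fun k => D i k == D i' k).
    by rewrite card_ord => ->.
  rewrite bigA_distr coef_sum (bigID (fun K : {set 'I_m} => #|K| == j)) /=.
  rewrite [X in _ + X]big1 ?addr0 => [|K /negbTE Kj].
    apply: eq_bigr => K /eqP <-.
    by rewrite -big_mkcond /= scaler_prod prodr_const coefZ coefXn eqxx mulr1.
  rewrite -big_mkcond /= scaler_prod prodr_const coefZ coefXn.
  by rewrite eq_sym (_ : #|_| == j = false) ?mulr0.
transitivity (\sum_(K : {set 'I_m} | #|K| == j)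
    \sum_i \sum_i' (\prod_(k in K) b i i' k)%:C%C).
  rewrite rmorph_sum; apply: eq_bigr => K _; rewrite rmorph_sum /=.
  transitivity (\sum_(a : {ffun {k : 'I_m | k \in K} -> 'I_s.-1}) \sum_i \sum_i'
     \prod_(k : {k : 'I_m | k \in K})
       (c (a k) (D i (val k)) * (c (a k) (D i' (val k)))^* )).
    apply: eq_bigr => a _.
    set z := \sum_(i < N) _.
    transitivity (z * z^*); first by rewrite rmorphXn /= -normCK.
    rewrite mulr_suml; apply: eq_bigr => i _.
    rewrite rmorph_sum mulr_sumr; apply: eq_bigr => i' _.
    by rewrite rmorph_prod -big_split.
  rewrite exchange_big; apply: eq_bigr => i _ /=.
  rewrite exchange_big; apply: eq_bigr => i' _ /=.
  rewrite -(bigA_distr_bigA (fun (k : {k | k \in K}) a =>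
      c a (D i (val k)) * (c a (D i' (val k)))^* )) /=.
  rewrite rmorph_prod [RHS]big_sub /=; apply: eq_bigr => k _.
  by rewrite dual rmorphB rmorphM !rmorph_nat rmorph1.
rewrite exchange_big rmorph_sum; apply: eq_bigr => i _.
rewrite exchange_big rmorph_sum; apply: eq_bigr => i' _.
by rewrite /= krawE rmorph_sum.
Qed.

(** For power series with constant term 1 the functionals [p_1] and
    [2 p_2 - p_1 ^ 2] turn products into sums. *)
Lemma coef12_powM (R : comNzRingType) (a b : R) (d e : nat) :
  let p := (1 + a *: 'X) ^+ d * (1 + b *: 'X) ^+ e in
  [/\ p`_0 = 1, p`_1 = d%:R * a + e%:R * b
    & 2 * p`_2 = p`_1 ^+ 2 - (d%:R * a ^+ 2 + e%:R * b ^+ 2)].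
Proof.
pose P (p : {poly R}) x y :=
  [/\ p`_0 = 1, p`_1 = x & 2 * p`_2 = p`_1 ^+ 2 - y].
have P1 : P 1 0 0 by split; rewrite ?coef1 //= expr0n subr0 mulr0.
have PM p q x y x' y' : P p x y -> P q x' y' -> P (p * q) (x + x') (y + y').
  move=> [p0 p1 p2] [q0 q1 q2].
  have pq0 : (p * q)`_0 = 1 by rewrite coefM big_ord1 p0 q0 mulr1.
  have pq1 : (p * q)`_1 = x + x'.
    by rewrite coefM big_ord_recl big_ord1 /= p0 q0 p1 q1 mul1r mulr1 addrC.
  split=> //; rewrite coefM 2!big_ord_recl big_ord1 /= pq1.
  rewrite p0 q0 mul1r mulr1 2!mulrDr p2 q2 p1 q1; ring.
have PX x n : P ((1 + x *: 'X) ^+ n) (n%:R * x) (n%:R * x ^+ 2).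
  elim: n => [|n IHn]; first by rewrite expr0 !mul0r.
  rewrite exprS -[n.+1]add1n natrD 2!(mulrDl 1 n%:R) !mul1r; apply: PM IHn.
  split; rewrite coefD coef1 coefZ coefX /= ?mulr0 ?mulr1 ?addr0 ?add0r //.
  by rewrite coefD coef1 coefZ coefX /= mulr1 add0r subrr mulr0.
exact: PM.
Qed.

Section Krawtchouk.
Variables (R : realType) (s m d : nat).
Hypothesis dm : (d <= m)%N.

Lemma krawtchouk1 : krawtchouk R s m 1 d = s%:R * d%:R - m%:R.
Proof.
rewrite /krawtchouk -scaleN1r.
case: (coef12_powM (s%:R - 1 : R) (-1) d (m - d)) => _ -> _.
by rewrite natrB //; ring.
Qed.

Lemma krawtchouk2 : krawtchouk R s m 2 d =
  (s%:R ^+ 2 * d%:R ^+ 2 - (2 * s%:R * m%:R + s%:R ^+ 2 - 2 * s%:R) * d%:R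
   + m%:R ^+ 2 - m%:R) / 2.
Proof.
have := krawtchouk1; rewrite /krawtchouk -scaleN1r.
case: (coef12_powM (s%:R - 1 : R) (-1) d (m - d)) => _ _ h2 h1.
have n2 : 2 != 0 :> R by rewrite pnatr_eq0.
have {}h2 := canRL (mulKf n2) h2.
by rewrite h2 h1 natrB //; field.
Qed.

End Krawtchouk.

(** * Optimality of designs with nearly constant coincidence numbers *)

Section Optimality.
Variables (R : realType) (s N m : nat).
Hypotheses (s_gt0 : (0 < s)%N) (N_gt1 : (1 < N)%N).
Implicit Type D : 'M['I_s]_(N, m).

Lemma coinc_refl D i : coinc D i i = m.
Proof.
by rewrite /coinc (eq_card (B := 'I_m)) ?card_ord // => k; rewrite inE eqxx.
Qed.

Lemma coinc_le D i j : (coinc D i j <= m)%N.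
Proof. by rewrite /coinc -[leqRHS](card_ord m) max_card. Qed.

(** The average of [coinc D i j] over the pairs [i != j], which is the same
    for all balanced designs ([sum_coinc]). *)
Definition avg_coinc : R := m%:R * (N%:R - s%:R) / ((N%:R - 1) * s%:R).

Lemma sum_coinc D : is_ssd D ->
  \sum_i \sum_(j | j != i) (coinc D i j)%:R = N%:R * (N%:R - 1) * avg_coinc.
Proof.
move=> bD.
have s0 : s%:R != 0 :> R by rewrite pnatr_eq0 -lt0n.
have N1 : N%:R - 1 != 0 :> R by rewrite subr_eq0 pnatr_eq1 gtn_eqF.
have row i : \sum_(j | j != i) (coinc D i j)%:R = m%:R * (N%:R / s%:R - 1) :> R.
  apply: (@addrI _ (coinc D i i)%:R); rewrite -(bigD1 i (P := predT)) //=.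
  rewrite -natr_sum.
  under eq_bigr do rewrite /coinc -sum1dep_card big_mkcond /=.
  rewrite exchange_big /= natr_sum coinc_refl.
  rewrite (eq_bigr (fun=> N%:R / s%:R)) => [|k _].
    by rewrite sumr_const card_ord -[_ *+ m]mulr_natl; ring.
  have -> : N%:R / s%:R = #|[set j | D j k == D i k]|%:R :> R.
    by rewrite -[in N%:R](bD k (D i k)) natrM mulfK.
  rewrite -big_mkcond sum1dep_card; congr _%:R.
  by apply: eq_card => j; rewrite !inE eq_sym.
under eq_bigr do rewrite row.
rewrite sumr_const card_ord -[_ *+ N]mulr_natl /avg_coinc; field.
by rewrite s0 N1.
Qed.

(** Any two distinct rows agree in [t] or [t + 1] columns. *)
Definition near_constant (t : nat) D :=
  forall i j, i != j -> coinc D i j = t \/ coinc D i j = t.+1.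

(** The sum of [f (coinc D i j)] over the ordered pairs [i != j]. *)
Definition offdiag (f : nat -> R) D : R :=
  \sum_i \sum_(j | j != i) f (coinc D i j).

Lemma eq_offdiag f g D :
  (forall i j, i != j -> f (coinc D i j) = g (coinc D i j)) ->
  offdiag f D = offdiag g D.
Proof.
move=> fg; apply: eq_bigr => i _; apply: eq_bigr => j ji.
by rewrite fg // eq_sym.
Qed.

Lemma offdiagD f g D :
  offdiag (fun d => f d + g d) D = offdiag f D + offdiag g D.
Proof. by rewrite -big_split; apply: eq_bigr => i _; rewrite -big_split. Qed.

Lemma offdiagZ a f D : offdiag (fun d => a * f d) D = a * offdiag f D.
Proof. by rewrite mulr_sumr; apply: eq_bigr => i _; rewrite mulr_sumr. Qed.

Lemma offdiag_const a D : offdiag (fun=> a) D = N%:R * (N%:R - 1) * a.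
Proof.
rewrite /offdiag; under eq_bigr do rewrite sumr_const cardC1 card_ord.
rewrite sumr_const card_ord -[_ *+ N]mulr_natl -[_ *+ N.-1]mulr_natl mulrA.
by rewrite -subn1 natrB // ltnW.
Qed.

Lemma ler_offdiag f g D :
  (forall i j, i != j -> f (coinc D i j) <= g (coinc D i j)) ->
  offdiag f D <= offdiag g D.
Proof.
move=> fg; apply: ler_sum => i _; apply: ler_sum => j ji.
by rewrite fg // eq_sym.
Qed.

Lemma offdiag_affine a b D : is_ssd D ->
  offdiag (fun d => a + b * d%:R) D = N%:R * (N%:R - 1) * (a + b * avg_coinc).
Proof.
move=> bD; rewrite offdiagD offdiag_const offdiagZ [offdiag _ D]sum_coinc //.
by ring.
Qed.

Lemma offdiag_near_constant t D f : is_ssd D -> near_constant t D ->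
  offdiag f D = N%:R * (N%:R - 1) * (f t + (avg_coinc - t%:R) * (f t.+1 - f t)).
Proof.
move=> bD ncD.
rewrite (@eq_offdiag _ (fun d =>
  (f t - t%:R * (f t.+1 - f t)) + (f t.+1 - f t) * d%:R)).
  by rewrite offdiag_affine //; ring.
by move=> i j /ncD[] ->; rewrite -?[t.+1%:R]natr1; ring.
Qed.

Lemma gwp_offdiag (c : 'I_s.-1 -> 'I_s -> R[i]) D j : orthonormal_contrasts c ->
  gwp c D j =
    N%:R ^- 2 * (N%:R * krawtchouk R s m j m + offdiag (krawtchouk R s m j) D).
Proof.
move=> /contrasts_dual/gwpE ->; congr (_ * _).
under eq_bigr => i _ do rewrite (bigD1 i) //= coinc_refl.
by rewrite big_split /= sumr_const card_ord mulr_natl.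
Qed.

(** A sum of nonnegative terms, as no integer lies strictly between [t] and
    [t + 1]; it measures how far [D] is from [near_constant t]. *)
Definition excess t D : R :=
  offdiag (fun d => (d%:R - t%:R) * (d%:R - t.+1%:R)) D.

Lemma dist_ge0 (d t : nat) : 0 <= (d%:R - t%:R) * (d%:R - t.+1%:R) :> R.
Proof.
have [dt|td] := leqP d t.
  by rewrite mulr_le0 // subr_le0 ler_nat // ltnW.
by rewrite mulr_ge0 // subr_ge0 ler_nat // ltnW.
Qed.

Lemma excess_ge0 t D : 0 <= excess t D.
Proof. by do 2 apply: sumr_ge0 => ? _; exact: dist_ge0. Qed.

Lemma excess_eq0 t D : excess t D = 0 <-> near_constant t D.
Proof.
split=> [e0 i j ij|ncD]; last first.
  rewrite /excess (@eq_offdiag _ (fun=> 0)) ?offdiag_const ?mulr0 //.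
  by move=> i j /ncD[] ->; rewrite subrr ?mul0r ?mulr0.
have ei : \sum_(j | j != i)
    ((coinc D i j)%:R - t%:R) * ((coinc D i j)%:R - t.+1%:R) = 0 :> R.
  apply: (psumr_eq0P _ e0) => // k _.
  by apply: sumr_ge0 => ? _; exact: dist_ge0.
have /eqP :
    ((coinc D i j)%:R - t%:R) * ((coinc D i j)%:R - t.+1%:R) = 0 :> R.
  by apply: (psumr_eq0P _ ei) => [k _|]; [exact: dist_ge0|rewrite eq_sym].
by rewrite mulf_eq0 !subr_eq0 !eqr_nat => /orP[] /eqP; [left|right].
Qed.

(** With [t] the integer part of [avg_coinc] the first two terms are the lower
    bound for [A_2]. *)
Lemma gwp2_excess (c : 'I_s.-1 -> 'I_s -> R[i]) t D :
  orthonormal_contrasts c -> is_ssd D ->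
  gwp c D 2 =
    m%:R * (s%:R - 1) * (m%:R * s%:R - m%:R - N%:R + 1) / (2 * (N%:R - 1))
    + (N%:R - 1) * s%:R ^+ 2
      * ((avg_coinc - t%:R) * (t.+1%:R - avg_coinc)) / (2 * N%:R)
    + s%:R ^+ 2 / (2 * N%:R ^+ 2) * excess t D.
Proof.
move=> oc bD; rewrite gwp_offdiag // krawtchouk2 //.
rewrite (@eq_offdiag _ (fun d =>
  ((m%:R ^+ 2 - m%:R - s%:R ^+ 2 * t%:R * t.+1%:R) / 2
   + (s%:R ^+ 2 * (t%:R + t.+1%:R)
      - (2 * s%:R * m%:R + s%:R ^+ 2 - 2 * s%:R)) / 2 * d%:R)
  + s%:R ^+ 2 / 2 * ((d%:R - t%:R) * (d%:R - t.+1%:R)))); last first.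
  by move=> i j _; rewrite krawtchouk2 ?coinc_le //; field.
rewrite offdiagD offdiagZ offdiag_affine // -/(excess t D) /avg_coinc.
rewrite -[t.+1%:R]natr1; field.
by rewrite !pnatr_eq0 -!lt0n s_gt0 (ltnW N_gt1) subr_eq0 pnatr_eq1 gtn_eqF.
Qed.

Lemma avg_coinc_near_constant t D : is_ssd D -> near_constant t D ->
  t%:R <= avg_coinc <= t.+1%:R.
Proof.
move=> bD ncD.
have NN : 0 < N%:R * (N%:R - 1) :> R.
  by rewrite mulr_gt0 ?ltr0n ?subr_gt0 ?ltr1n // ltnW.
rewrite -(ler_pM2l NN) -[_ <= t.+1%:R](ler_pM2l NN) -(offdiag_const t%:R D)
  -(offdiag_const t.+1%:R D) -(sum_coinc bD).
apply/andP; split; apply: ler_offdiag => i j /ncD[] ->; by rewrite ler_nat.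
Qed.

(** Both sides vanish when [avg_coinc] is [t + 1], although its integer part is
    then not [t]. *)
Lemma eta_itv (t : nat) : t%:R <= avg_coinc <= t.+1%:R ->
  eta R s N m * (1 - eta R s N m) = (avg_coinc - t%:R) * (t.+1%:R - avg_coinc).
Proof.
have floor_nat (n : nat) (x : R) : n%:R <= x < n.+1%:R ->
    (Num.floor x)%:~R = n%:R :> R.
  by move=> nx; rewrite (@floor_def _ x n) // intrD -!pmulrn natr1.
rewrite /eta -/avg_coinc => /andP[tx]; rewrite le_eqVlt => /orP[/eqP xt|xt].
  by rewrite xt (floor_nat t.+1) ?lexx ?ltr_nat ?ltnSn //; ring.
by rewrite (floor_nat t) ?tx // -[t.+1%:R]natr1; ring.
Qed.

Lemma near_constant_gma t D : is_ssd D -> near_constant t D ->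
  has_gma_ssd_attaining_bound R s N m.
Proof.
move=> bD ncD; exists D; split=> // c oc; split; last first.
  rewrite (gwp2_excess t) // (excess_eq0 t D).2 // mulr0 addr0 /A2_bound.
  rewrite -[_ * eta _ _ _ _ * _]mulrA (eta_itv (t := t)) //.
  exact: avg_coinc_near_constant.
move=> [D' [r [bD' /andP[r1 rm] eqA ltA]]].
have ex2 : s%:R ^+ 2 / (2 * N%:R ^+ 2) > 0 :> R.
  by rewrite divr_gt0 ?mulr_gt0 ?exprn_gt0 ?ltr0n // ltnW.
have A2D' : gwp c D' 2 = gwp c D 2 + s%:R ^+ 2 / (2 * N%:R ^+ 2) * excess t D'.
  by rewrite !(gwp2_excess t) // (excess_eq0 t D).2 // mulr0 addr0.
move: r r1 rm eqA ltA => [//|[|[|r]]] _ _ eqA.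
- (* A_1 is the same for all balanced designs. *)
  rewrite !gwp_offdiag // ltr_pM2l; last first.
    by rewrite invr_gt0 exprn_gt0 // ltr0n ltnW.
  rewrite ltrD2l.
  have A1 D0 : is_ssd D0 -> offdiag (krawtchouk R s m 1) D0 =
      N%:R * (N%:R - 1) * (- m%:R + s%:R * avg_coinc).
    move=> bD0; rewrite -(@offdiag_affine _ _ D0) //.
    by apply: eq_offdiag => i j _; rewrite krawtchouk1 ?coinc_le // addrC.
  by rewrite !A1 // ltxx.
- by rewrite A2D' gtrDl pmulr_rlt0 // ltNge excess_ge0.
(* A_2 is minimal for D' too, so D' is near constant with the same t, which
   determines its whole wordlength pattern. *)
have /excess_eq0 ncD' : excess t D' = 0.
  have /eqP := eqA 2 isT; rewrite A2D' -subr_eq0 addrC addKr mulf_eq0.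
  by rewrite gt_eqF //= => /eqP.
by rewrite !gwp_offdiag // !(offdiag_near_constant _ _ (t := t)) // ltxx.
Qed.

End Optimality.

(** * Designs from lists of columns *)

(** Every symbol is taken equally often by the column [f]; rows and symbols are
    the elements of [T] and [S]. *)
Definition balanced (T S : finType) (f : T -> S) : Prop :=
  forall x, (#|[set r | f r == x]| * #|S|)%N = #|T|.

(** Columns are given by a list [ps] of labels, possibly with repetitions. *)
Lemma columns_gma (R : realType) (T S : finType) (I : eqType)
    (col : I -> T -> S) (ps : seq I) (t : nat) :
  (0 < #|S|)%N -> (1 < #|T|)%N ->
  {in ps, forall p, balanced (col p)} ->
  (forall x y, x != y ->
    t <= count (fun p => col p x == col p y) ps <= t.+1)%N ->
  has_gma_ssd_attaining_bound R #|S| #|T| (size ps).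
Proof.
move=> S0 T1 bal agr.
pose D := \matrix_(i < #|T|, k < size ps)
  enum_rank (col (tnth (in_tuple ps) k) (enum_val i)).
apply: (@near_constant_gma _ _ _ _ _ _ t D) => // [k x|i j ij].
  have balk := bal _ (mem_tnth k (in_tuple ps)) (enum_val x).
  rewrite -[RHS]balk; congr (_ * _)%N.
  rewrite -(card_imset _ (@enum_val_inj _ T)); apply: eq_card => r.
  rewrite !inE; apply/imsetP/eqP => [[r'] | rx].
    by rewrite inE mxE => /eqP <- ->; rewrite enum_rankK.
  exists (enum_rank r); rewrite ?enum_rankK //.
  by rewrite inE mxE enum_rankK rx enum_valK.
have -> : coinc D i j =
    count (fun p => col p (enum_val i) == col p (enum_val j)) ps.
  rewrite -sum1_count (big_tnth _ _ ps) sum1dep_card.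
  by apply: eq_card => k; rewrite !inE !mxE (inj_eq enum_rank_inj).
have /andP[] := agr _ _ (contra_neq (@enum_val_inj _ _ i j) ij).
by lia.
Qed.

(** * Linear functionals over a finite field *)

Section Functionals.
Variable F : finFieldType.
Local Notation q := #|F|.

(** The standard bilinear form on [F^n]. *)
Definition dot n (x a : 'rV[F]_n) : F := (x *m a^T) 0 0.

Lemma dotC n (x a : 'rV[F]_n) : dot x a = dot a x.
Proof. by rewrite /dot !mxE; apply: eq_bigr => i _; rewrite !mxE mulrC. Qed.

Lemma dotBl n (x y a : 'rV[F]_n) : dot (x - y) a = dot x a - dot y a.
Proof. by rewrite /dot mulmxBl !mxE. Qed.

Lemma dotDr n (x a b : 'rV[F]_n) : dot x (a + b) = dot x a + dot x b.
Proof. by rewrite /dot linearD mulmxDr mxE. Qed.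

Lemma dotZr n c (x a : 'rV[F]_n) : dot x (c *: a) = c * dot x a.
Proof. by rewrite /dot linearZ -scalemxAr mxE. Qed.

Lemma dot_row_mx n x y (v w : 'rV[F]_n) :
  dot (row_mx x v : 'rV_(1 + n)) (row_mx y w) = x 0 0 * y 0 0 + dot v w.
Proof.
rewrite /dot tr_row_mx mul_row_col mxE [(x *m _) _ _]mxE.
by rewrite big_ord1 [y^T _ _]mxE.
Qed.

(** All fibres of a nonzero functional are translates of each other. *)
Lemma card_dot n (w : 'rV[F]_n) z : w != 0 ->
  (#|[set a | dot w a == z]| * q)%N = (q ^ n)%N.
Proof.
move=> /rV0Pn[i wi0].
pose a0 := (w 0 i)^-1 *: delta_mx 0 i : 'rV[F]_n.
have wa0 : dot w a0 = 1.
  rewrite dotZr /dot trmx_delta mxE (bigD1 i) //= big1 ?addr0 => [|j ji].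
    by rewrite mxE !eqxx mulr1 mulVf.
  by rewrite mxE (negbTE ji) mulr0.
(* Translation by (z - y) a0 maps the fibre over y onto the fibre over z. *)
have fib y : #|[set a | dot w a == y]| = #|[set a | dot w a == z]|.
  rewrite -(card_imset _ (addrI ((z - y) *: a0))); apply: eq_card => a.
  rewrite inE; apply/imsetP/eqP => [[b] | az].
    by rewrite inE => /eqP <- ->; rewrite dotDr dotZr wa0 mulr1 subrK.
  exists (- ((z - y) *: a0) + a); last by rewrite addNKr.
  by rewrite inE -scaleNr dotDr dotZr wa0 az mulr1 opprB subrK.
transitivity (#|{: 'rV[F]_n}|); last by rewrite card_mx mul1n.
rewrite -[RHS]sum1_card [RHS](partition_big (dot w) predT) //=.
rewrite [RHS](eq_bigr (fun=> #|[set a | dot w a == z]|)) => [|y _].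
  by rewrite sum_nat_const mulnC.
by rewrite -(fib y) sum1dep_card.
Qed.

(** The points of the projective space of [F^n], represented by the vectors
    whose first nonzero coordinate is 1; (1, 0, ..., 0) comes first. *)
Fixpoint points n : seq 'rV[F]_n :=
  if n is n'.+1 then
    (row_mx 1%:M 0 : 'rV_(1 + n')) ::
    ([seq row_mx 1%:M a : 'rV_(1 + n') | a <- rem 0 (enum {: 'rV[F]_n'})] ++
     [seq row_mx 0 p : 'rV_(1 + n') | p <- points n'])
  else [::].

(** The points other than (1, 0, ..., 0). *)
Definition rest n : seq 'rV[F]_(1 + n) := behead (points n.+1).

Lemma count_points n (P : pred 'rV[F]_(1 + n)) :
  count P (points n.+1) =
    (#|[set a | P (row_mx 1%:M a)]|
     + count (fun p => P (row_mx 0 p)) (points n))%N.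
Proof.
rewrite /= count_cat !count_map addnA; congr (_ + _)%N.
have /permP/(_ (preim (row_mx 1%:M) P)) :=
  perm_to_rem (mem_enum {: 'rV[F]_n} 0).
by rewrite /= => <-; rewrite -sum1dep_card -sum1_count big_enum_cond.
Qed.

Lemma row_mx1_neq0 n (a : 'rV[F]_n) : row_mx (1%:M : 'M_1) a != 0.
Proof. by rewrite row_mx_eq0 (negbTE (matrix_nonzero1 F 0)). Qed.

Lemma row_mx0_neq0 n (a : 'rV[F]_n) : a != 0 -> row_mx (0 : 'M_1) a != 0.
Proof. by move=> a0; rewrite row_mx_eq0 eqxx. Qed.

Lemma points_neq0 n p : p \in points n -> p != 0.
Proof.
elim: n p => [//|n IHn] p; rewrite inE mem_cat.
move=> /or3P[/eqP-> | /mapP[a _ ->] | /mapP[a /IHn a0 ->]].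
- exact: row_mx1_neq0.
- exact: row_mx1_neq0.
- exact: row_mx0_neq0.
Qed.

Lemma rest_rsubmx_neq0 n p : p \in rest n -> rsubmx p != 0.
Proof.
rewrite mem_cat => /orP[/mapP[a + ->] | /mapP[a /points_neq0 a0 ->]].
  by rewrite row_mxKr mem_rem_uniq ?enum_uniq // inE => /andP[].
by rewrite row_mxKr.
Qed.

Lemma size_pointsS n : size (points n.+1) = (q ^ n + size (points n))%N.
Proof.
rewrite -[LHS]count_predT count_points count_predT; congr (_ + _)%N.
rewrite (eq_card (B := {: 'rV[F]_n})) => [|a]; first by rewrite card_mx mul1n.
by rewrite !inE.
Qed.

Lemma size_points n : size (points n) = ((q ^ n - 1) %/ (q - 1))%N.
Proof.
have q1 : (1 < q)%N by exact: finNzRing_gt1.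
have <- : (size (points n) * (q - 1) = q ^ n - 1)%N;
  last by rewrite mulnK ?subn_gt0.
elim: n => [//|n IHn]; rewrite size_pointsS mulnDl IHn mulnBr muln1 -expnSr.
by rewrite addnBA ?subnK ?leq_pexp2l ?expn_gt0 // ltnW.
Qed.

(** Every nonzero vector is orthogonal to the same number of points, those of a
    projective hyperplane. *)
Lemma count_points_dot n (w : 'rV[F]_(1 + n)) : w != 0 ->
  count (fun p => dot w p == 0) (points n.+1) = size (points n).
Proof.
(* The points (1, a) orthogonal to (x, v) are given by v . a = - x, the points
   (0, p) by v . p = 0. *)
have step k (x : 'M_1) (v : 'rV[F]_k) :
    count (fun p => dot (row_mx x v : 'rV_(1 + k)) p == 0) (points k.+1)
    = (#|[set a | dot v a == (- x 0 0)%R]|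
       + count (fun p => dot v p == 0%R) (points k))%N.
  rewrite count_points; congr (_ + _)%N.
    apply: eq_card => a.
    by rewrite !inE dot_row_mx !mxE mulr1 addrC addr_eq0.
  by apply: eq_count => p; rewrite dot_row_mx !mxE mulr0 add0r.
have zero k (x : 'M_1) : x != 0 ->
    (#|[set a : 'rV_k | dot 0 a == (- x 0 0)%R]|
     + count (fun p => dot 0 p == 0%R) (points k))%N = size (points k).
  move=> x0; have dot0 (a : 'rV_k) : dot 0 a = 0 by rewrite /dot mul0mx mxE.
  rewrite eq_card0 => [|a].
    rewrite (eq_count (a2 := predT)) ?count_predT // => p.
    by rewrite dot0 eqxx.
  rewrite inE dot0 eq_sym oppr_eq0; apply: contraNF x0 => /eqP x00.
  by rewrite [x]mx11_scalar x00 raddf0.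
elim: n w => [|n IHn] w; rewrite -(hsubmxK w) step;
  move: (lsubmx _) (rsubmx _) => x v; rewrite row_mx_eq0 negb_and.
  by rewrite [v]thinmx0 eqxx orbF; exact: zero.
have [-> | v0 _] := eqVneq v 0; first by rewrite orbF; exact: zero.
rewrite (IHn v v0) size_pointsS; congr (_ + _)%N.
have q0 : (0 < q)%N by apply/card_gt0P; exists 0.
by apply/eqP; rewrite -(eqn_pmul2r q0) card_dot // expnSr.
Qed.

Lemma count_rest_dot n (w : 'rV[F]_(1 + n)) : w != 0 ->
  ((dot w (row_mx 1%:M 0) == 0)%R + count (fun p => dot w p == 0%R) (rest n))%N
  = size (points n).
Proof. exact: count_points_dot. Qed.

Lemma size_rest n : (size (rest n)).+1 = size (points n.+1).
Proof. by []. Qed.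

(** * Optimal designs made of linear functionals *)

Let q_gt1 : (1 < q)%N := finNzRing_gt1 F.

Lemma linear_gma (R : realType) n (ps : seq 'rV[F]_n) (t : nat) :
  (0 < n)%N -> {in ps, forall p, p != 0} ->
  (forall w, w != 0 -> (t <= count (fun p => dot w p == 0%R) ps <= t.+1)%N) ->
  has_gma_ssd_attaining_bound R q (q ^ n) (size ps).
Proof.
move=> n0 ps0 cnt.
have cardT : #|{: 'rV[F]_n}| = (q ^ n)%N by rewrite card_mx mul1n.
rewrite -cardT; apply: (@columns_gma _ _ _ _ (fun p x => dot x p) _ t).
- exact: ltnW.
- by rewrite cardT -(expn0 q) ltn_exp2l.
- move=> p /ps0 p0 z; rewrite cardT -(card_dot z p0); congr (_ * _)%N.
  by apply: eq_card => x; rewrite !inE dotC.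
move=> x y; rewrite -subr_eq0 => /cnt.
rewrite (eq_count (a2 := fun p => dot x p == dot y p)) // => p.
by rewrite dotBl subr_eq0.
Qed.

(** The rows of the design are the vectors of [F^(1 + n)] whose first coordinate
    belongs to a given set of [k] elements. *)
Lemma restricted_linear_gma (R : realType) n k (ps : seq 'rV[F]_(1 + n))
    (t : nat) :
  (0 < n)%N -> (0 < k <= q)%N -> {in ps, forall p, rsubmx p != 0} ->
  (forall w, w != 0 -> (t <= count (fun p => dot w p == 0%R) ps <= t.+1)%N) ->
  has_gma_ssd_attaining_bound R q (k * q ^ n) (size ps).
Proof.
move=> n0 /andP[k0 kq] ps0 cnt.
pose T := ('I_k * 'rV[F]_n)%type.
pose f (i : 'I_k) : F := enum_val (widen_ord kq i).
have f_inj : injective f by move=> i j /enum_val_inj [] /val_inj.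
pose vec (r : T) : 'rV[F]_(1 + n) := row_mx (f r.1)%:M r.2.
have vec_inj : injective vec.
  move=> [i x] [j y] /eq_row_mx [] /= /matrixP/(_ 0 0).
  by rewrite !mxE => /f_inj -> ->.
have cardT : #|{: T}| = (k * q ^ n)%N.
  by rewrite card_prod card_ord card_mx mul1n.
rewrite -cardT; apply: (@columns_gma _ _ _ _ (fun p r => dot (vec r) p) _ t).
- exact: ltnW.
- rewrite cardT -[1%N]muln1 -(expn0 q).
  apply: (@leq_trans (1 * q ^ n)); first by rewrite !mul1n ltn_exp2l.
  by rewrite leq_pmul2r // expn_gt0 ltnW.
- move=> p /ps0 p0 z; rewrite cardT -sum1dep_card.
  (* For each first coordinate, the others have to solve an affine equation. *)
  rewrite -(pair_big_dep predT (fun i x => dot (vec (i, x)) p == z)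
    (fun _ _ => 1%N)) /=.
  rewrite big_distrl /= (eq_bigr (fun=> (q ^ n)%N)) => [|i _].
    by rewrite sum_nat_const card_ord.
  rewrite sum1dep_card -(card_dot (z - f i * lsubmx p 0 0) p0); congr (_ * _)%N.
  apply: eq_card => x.
  rewrite !inE -{1}(hsubmxK p) dot_row_mx [_%:M _ _]mxE mulr1n.
  by rewrite dotC [RHS]eq_sym subr_eq addrC eq_sym.
move=> x y xy; have /cnt : vec x - vec y != 0.
  by rewrite subr_eq0 (inj_eq vec_inj).
rewrite (eq_count (a2 := fun p => dot (vec x) p == dot (vec y) p)) // => p.
by rewrite dotBl subr_eq0.
Qed.

Lemma count_copies (I : Type) (P : pred I) k (ps : seq I) :
  count P (flatten (nseq k ps)) = (k * count P ps)%N.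
Proof. by rewrite count_flatten map_nseq sumn_nseq mulnC. Qed.

Lemma mem_copies (I : eqType) k (ps : seq I) :
  {subset flatten (nseq k ps) <= ps}.
Proof. by move=> x /flattenP[r /nseqP[-> _]]. Qed.

Section Saturated.
Variables (R : realType) (n : nat).

(** The points of the projective space, each taken [k] times. *)
Lemma copies_gma k :
  has_gma_ssd_attaining_bound R q (q ^ n.+1) (k * size (points n.+1)).
Proof.
have <- : size (flatten (nseq k (points n.+1))) = (k * size (points n.+1))%N.
  by rewrite -count_predT count_copies count_predT.
apply: (@linear_gma _ _ _ (k * size (points n))) => // [p|w w0].
  by move=> /mem_copies/points_neq0.
by rewrite count_copies count_points_dot // leqnn leqnSn.
Qed.

Lemma copies_add1_gma k :
  has_gma_ssd_attaining_bound R q (q ^ n.+1) (k * size (points n.+1) + 1).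
Proof.
pose p0 := head 0 (points n.+1).
have <- : size (p0 :: flatten (nseq k (points n.+1))) =
    (k * size (points n.+1) + 1)%N.
  by rewrite addn1 -[in RHS](count_predT (points _)) -count_copies count_predT.
apply: (@linear_gma _ _ _ (k * size (points n))) => // [p|w w0].
  rewrite inE => /orP[/eqP-> | /mem_copies/points_neq0 //].
  exact: row_mx1_neq0.
rewrite [count _ _]/= count_copies count_points_dot //.
by case: (_ == _); rewrite ?add0n ?add1n leqnn ?leqnSn.
Qed.

Lemma copies_sub1_gma k : (0 < k)%N ->
  has_gma_ssd_attaining_bound R q (q ^ n.+1) (k * size (points n.+1) - 1).
Proof.
case: k => // k _.
have <- : size (rest n ++ flatten (nseq k (points n.+1))) =
    (k.+1 * size (points n.+1) - 1)%N.
  rewrite size_cat -[size (flatten _)]count_predT count_copies count_predT.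
  by rewrite mulSn -size_rest subn1.
apply: (@linear_gma _ _ _ (k.+1 * size (points n) - 1)) => // [p|w w0].
  by rewrite mem_cat => /orP[/mem_behead|/mem_copies] /points_neq0.
rewrite count_cat count_copies count_points_dot // mulSn.
move: (count_rest_dot w0); set c := count _ _; by case: (_ == _); lia.
Qed.

(** Two of the kept rows have one coincidence less than in the full design when
    they agree in the first coordinate, and equally many otherwise. *)
Lemma rest_gma k : (0 < n)%N -> (0 < k < q)%N ->
  has_gma_ssd_attaining_bound R q (k * q ^ n) (size (points n.+1) - 1).
Proof.
move=> n0 /andP[k0 kq]; rewrite -size_rest subn1.
apply: (@restricted_linear_gma _ _ _ _ (size (points n) - 1)) => //.
- by rewrite k0 ltnW.
- exact: rest_rsubmx_neq0.
move=> w w0; have n1 : (0 < size (points n))%N by case: n n0.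
have := count_rest_dot w0.
by case: (_ == _); lia.
Qed.

End Saturated.

Lemma size_points2 : size (points 2) = q.+1.
Proof. by rewrite !size_pointsS addn0 addn1. Qed.

Lemma count_points2_dot (w : 'rV[F]_(1 + 1)) : w != 0 ->
  count (fun p => dot w p == 0) (points 2) = 1.
Proof. by move=> w0; rewrite (count_points_dot w0) size_pointsS. Qed.

(** With [m = k (q + 1) + r], all the [q + 1] points of the projective line are
    taken [k] times, followed by [r] of them. *)
Lemma plane_gma (R : realType) m : has_gma_ssd_attaining_bound R q (q ^ 2) m.
Proof.
pose k := (m %/ q.+1)%N; pose r := (m %% q.+1)%N.
have <- : size (flatten (nseq k (points 2)) ++ take r (points 2)) = m.
  rewrite size_cat -[size (flatten _)]count_predT count_copies count_predT.
  rewrite size_takel size_points2; last by rewrite ltnW // ltn_mod.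
  by rewrite -divn_eq.
apply: (@linear_gma _ _ _ k) => // [p|w w0].
  by rewrite mem_cat => /orP[/mem_copies | /mem_take] /points_neq0.
rewrite count_cat count_copies.
rewrite (count_points2_dot w0) muln1 leq_addr -[k.+1]addn1 leq_add2l.
by rewrite -[leqRHS](count_points2_dot w0) leq_count_subseq ?take_subseq.
Qed.

Lemma restricted_plane_gma (R : realType) k m : (m <= q)%N -> (0 < k < q)%N ->
  has_gma_ssd_attaining_bound R q (k * q) m.
Proof.
move=> mq /andP[k0 kq].
have <- : size (take m (rest 1)) = m.
  by rewrite size_takel // -ltnS size_rest size_points2.
apply: (@restricted_linear_gma _ 1 _ _ 0) => //; first by rewrite k0 ltnW.
  by move=> p /mem_take /rest_rsubmx_neq0.
move=> w w0; rewrite leq0n -[leqRHS](count_points2_dot w0) leq_count_subseq //.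
exact: subseq_trans (take_subseq _ _) (subseq_cons _ _).
Qed.

End Functionals.

Theorem theorem2 (R : realType) (s : nat) (hs : prime_power s) :
  [/\
    (* (i) *)
    forall n k m : nat, (0 < n)%N -> (0 < k)%N -> (1 <= m)%N ->
      [\/ m = (k * ((s ^ n - 1) %/ (s - 1)))%N,
          m = (k * ((s ^ n - 1) %/ (s - 1)) + 1)%N
        | m = (k * ((s ^ n - 1) %/ (s - 1)) - 1)%N] ->
      has_gma_ssd_attaining_bound R s (s ^ n)%N m,
    (* (ii) *)
    forall n k m : nat, (0 < n)%N -> (0 < k < s)%N -> (1 <= m)%N ->
      m = ((s ^ n - 1) %/ (s - 1) - 1)%N ->
      has_gma_ssd_attaining_bound R s (k * s ^ (n - 1))%N m,
    (* (iii) *)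
    forall m : nat, (1 <= m)%N ->
      has_gma_ssd_attaining_bound R s (s ^ 2)%N m
    & (* (iv) *)
    forall k m : nat, (1 <= m <= s)%N -> (1 <= k < s)%N ->
      has_gma_ssd_attaining_bound R s (k * s)%N m].
Proof.
have [p [e [p_pr e0 ->]]] := hs; have [F _ <-] := pPrimePowerField p_pr e0.
split.
- move=> [//|n] k m _ k0 _; rewrite -size_points => -[] ->.
  + exact: copies_gma.
  + exact: copies_add1_gma.
  + exact: copies_sub1_gma.
- move=> [//|n] k m _ kq m0; rewrite -size_points [(n.+1 - 1)%N]subn1 => mE.
  rewrite mE; apply: rest_gma kq; case: n mE => // mE.
  (* The exponent 1 would give m = 0. *)
  by rewrite mE size_pointsS in m0.
- by move=> m _; exact: plane_gma.
- by move=> k m /andP[_ mq]; exact: restricted_plane_gma.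
Qed.
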